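(* Let $\alpha\in[\tfrac12,1)$. For $X\in L^1$ define $$s_\alpha(X):=\int_0^1 F_X^{-1}(u)\,\frac{\alpha(1-\alpha)}{\bigl(\alpha-u(2\alpha-1)\bigr)^2}\,\mathrm{d}u .$$ Then $s_\alpha$ is the smallest spectral risk measure larger than the expectile $e_\alpha$. That is, $s_\alpha$ is a spectral risk measure, $e_\alpha(X)\le s_\alpha(X)$ for all $X\in L^1$, and if $\mathcal R_\sigma$ is any spectral risk measure with $e_\alpha(X)\le\mathcal R_\sigma(X)$ for every $X\in L^1$, then $$e_\alpha(X)\le s_\alpha(X)\le \mathcal R_\sigma(X)\qquad\text{for all }X\in L^1 .$$
   Context: $(\Omega,\mathcal F,P)$ is a probability space and $L^1=L^1(P)$ is the space of real-valued integrable random variables; $x_+:=\max(0,x)$. Expectile: for $X\in L^1$ and $\alpha\in(0,1)$, $e_\alpha(X)$ is the unique $x\in\mathbb R$ solving $\alpha\,\mathbb E(X-x)_+=(1-\alpha)\,\mathbb E(x-X)_+$. Quantile function: $F_X^{-1}(u):=\inf\{x\in\mathbb R: P(X\le x)\ge u\}$ for $u\in(0,1)$. Spectral risk measure: let $\sigma\colon[0,1)\to\mathbb R_{\ge0}$ be a non-negative, non-decreasing function with $\int_0^1\sigma(u)\,\mathrm du=1$ (the spectrum). The spectral risk measure with spectrum $\sigma$ is $\mathcal R_\sigma(X):=\int_0^1F_X^{-1}(u)\,\sigma(u)\,\mathrm du$ for $X\in L^1$; its value may be $+\infty$ when $\sigma$ is unbounded. *)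

(* Defs.v *)
From HB Require Import structures.
From mathcomp Require Import all_boot all_order all_algebra.
From mathcomp Require Import all_classical all_reals all_analysis.

Set Implicit Arguments.
Unset Strict Implicit.
Unset Printing Implicit Defensive.

Import Order.TTheory GRing.Theory Num.Theory.
Import numFieldNormedType.Exports.

Local Open Scope classical_set_scope.
Local Open Scope ring_scope.

(* The equation below has exactly one solution when X \in Lfun P 1 and
   0 < alpha < 1; the default value 0 is irrelevant in that case. *)
Definition expectile d (T : measurableType d) (R : realType)
    (P : probability T R) (alpha : R) (X : {RV P >-> R}) : R :=
  xget 0 [set x : R |
    (alpha%:E * 'E_P[(fun w => Num.max 0 (X w - x))%R] =
     (1 - alpha)%R%:E * 'E_P[(fun w => Num.max 0 (x - X w))%R])%E].

(* For 0 < u < 1 the set is nonempty and bounded below, so that the real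
   infimum is the genuine one. *)
Definition quantile d (T : measurableType d) (R : realType)
    (P : probability T R) (X : {RV P >-> R}) (u : R) : R :=
  inf [set x : R | (u%:E <= cdf X x)%E].

(* A spectrum is a function on [0, 1[; its values elsewhere are unconstrained
   and never used. *)
Definition is_spectrum (R : realType) (sigma : R -> R) : Prop :=
  [/\ {in `[0, 1[, forall u, 0 <= sigma u},
      {in `[0, 1[ &, {homo sigma : u v / u <= v}} &
      (\int[@lebesgue_measure R]_(u in `[0%R, 1%R[) (sigma u)%:E = 1)%E].

Definition spectral_risk d (T : measurableType d) (R : realType)
    (P : probability T R) (sigma : R -> R) (X : {RV P >-> R}) : \bar R :=
  (\int[@lebesgue_measure R]_(u in `]0%R, 1%R[) (quantile X u * sigma u)%R%:E)%E.

Definition is_spectral_risk_measure d (T : measurableType d) (R : realType)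
    (P : probability T R) (sigma : R -> R) (rho : {RV P >-> R} -> \bar R) :
    Prop :=
  is_spectrum sigma /\
  forall X : {RV P >-> R}, (X : T -> R) \in Lfun P 1 ->
    rho X = spectral_risk sigma X.

Definition expectile_spectrum (R : realType) (alpha u : R) : R :=
  alpha * (1 - alpha) / (alpha - u * (2 * alpha - 1)) ^+ 2.

Definition s_alpha d (T : measurableType d) (R : realType)
    (P : probability T R) (alpha : R) (X : {RV P >-> R}) : \bar R :=
  (\int[@lebesgue_measure R]_(u in `]0%R, 1%R[)
     (quantile X u * expectile_spectrum alpha u)%R%:E)%E.

(* Main.v *)
(* For w >= 0, layer-cake integration gives
     int max(0, g - c) w = int_{t > c} (int_{g > t} w) dt
   and its mirror image, so such integrals are compared through the tail masses
   int_{g > t} w alone.  With g the quantile function and w = sigma, the set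
   {g > t} is ]F t, 1[, and a spectral risk depends on sigma only through
   Sigma v = int_v^1 sigma at the points v = F t.  For the expectile spectrum,
   S v = alpha (1 - v) / (alpha - v (2 alpha - 1)).

   Domination: let x be the expectile, v = F x and N = alpha - v (2 alpha - 1).
   The bounds S w >= (alpha / N) (1 - w) for w >= v and
   1 - S w <= ((1 - alpha) / N) w for w <= v give
   s_alpha X - x >= (alpha E(X - x)_+ - (1 - alpha) E(x - X)_+) / N = 0.

   Minimality: the expectile of the indicator of {X > t} is S (F t), whereas its
   spectral risk is Sigma (F t); hence S (F t) <= Sigma (F t) for all t, on any
   probability space, with or without atoms. *)
Require Import Defs.
From HB Require Import structures.
From mathcomp Require Import all_boot all_order all_algebra.
From mathcomp Require Import all_classical all_reals all_analysis.
From mathcomp Require Import measurable_realfun.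
From mathcomp Require Import ring lra.
Import Order.TTheory GRing.Theory Num.Theory.
Import numFieldNormedType.Exports.
Local Open Scope classical_set_scope.
Local Open Scope ring_scope.

Set Implicit Arguments.
Unset Strict Implicit.
Unset Printing Implicit Defensive.

(** * Layer-cake formulas and comparison of weighted integrals through tail masses *)

Section layer_cake.
Context (R : realType).
Local Notation mu := (@lebesgue_measure R).
Local Open Scope ereal_scope.

(** Tonelli for [w x] times the indicator of [B], with [w] extended by zero off [D]. The
    measurability in [t] comes along for later comparisons of the outer integrals. *)
Lemma integral_sections d (T : measurableType d)
    (m : {sigma_finite_measure set T -> \bar R})
    (D : set T) (w : T -> R) (B : set (T * measurableTypeR R)) :
  measurable D -> measurable_fun D w -> (forall x, D x -> (0 <= w x)%R) ->
  measurable B ->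
  \int[m]_(x in D) ((w x)%:E * mu (xsection B x)) =
  \int[mu]_t \int[m]_(x in D `&` ysection B t) (w x)%:E
  /\ measurable_fun setT
       (fun t => \int[m]_(x in D `&` ysection B t) (w x)%:E).
Proof.
move=> mD mw w0 mB.
pose f (p : T * measurableTypeR R) : \bar R := ((w \_ D) p.1 * \1_B p)%:E.
have wD0 x : (0 <= (w \_ D) x)%R.
  by rewrite patchE; case: ifPn => // /set_mem; exact: w0.
have mf : measurable_fun setT f.
  apply/measurable_EFinP/measurable_funM => //.
  apply: (measurableT_comp _ measurable_fst).
  exact/(measurable_restrictT _ _).1.
have f0 p : 0 <= f p by rewrite lee_fin mulr_ge0.
have fG t : (\int[m]_(x in D `&` ysection B t) (w x)%:E = \int[m]_x f (x, t))%E.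
  rewrite integral_mkcond; apply: eq_integral => x _.
  rewrite /f !patchE in_setI indicE /= mem_ysection.
  by case: (x \in D) => /=; [case: (_ \in B)|]; rewrite ?(mulr0, mul0r, mulr1).
split; last first.
  under eq_fun do rewrite fG.
  exact: (measurable_fun_fubini_tonelli_G f).
under [RHS]eq_integral do rewrite fG.
rewrite -(fubini_tonelli f)// integral_mkcond; apply: eq_integral => x _.
have mBx : measurable (xsection B x) by exact: measurable_xsection.
transitivity (\int[mu]_t (((w \_ D) x)%:E * (\1_(xsection B x) t)%:E));
  last first.
  by apply: eq_integral => t _; rewrite /f EFinM !indicE mem_xsection.
rewrite ge0_integralZl_EFin//=; last first.
  by apply/measurable_EFinP; exact: measurable_indic.
rewrite integral_indic// setIT !patchE.
by case: ifPn => // _; rewrite mul0e.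
Qed.

Lemma integral_tail d (T : measurableType d)
    (m : {sigma_finite_measure set T -> \bar R})
    (D : set T) (w g : T -> R) (c : R) :
  measurable D -> measurable_fun D w -> (forall x, D x -> (0 <= w x)%R) ->
  measurable_fun D g ->
  \int[m]_(x in D) (Num.max 0 (g x - c) * w x)%R%:E =
  \int[mu]_t \int[m]_(x in D `&` [set x | c < t < g x]%R) (w x)%:E
  /\ measurable_fun setT
       (fun t => \int[m]_(x in D `&` [set x | c < t < g x]%R) (w x)%:E).
Proof.
move=> mD mw w0 mg.
(* The region between level [c] and the graph of [g]: its section at [x] is []c, g x[], of length
   [max 0 (g x - c)]. *)
pose B := [set p : T * measurableTypeR R | (c < p.2 < (g \_ D) p.1)%R].
have mgD : measurable_fun setT (fun p : T * measurableTypeR R => (g \_ D) p.1).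
  apply: (measurableT_comp _ measurable_fst).
  exact/(measurable_restrictT _ _).1.
have mB : measurable B.
  rewrite (_ : B = (fun p : T * measurableTypeR R =>
    (c < p.2) && (p.2 < (g \_ D) p.1))%R @^-1` [set true]).
    rewrite -[X in measurable X]setTI.
    by apply: measurable_and => //; exact: measurable_fun_ltr.
  by apply/seteqP; split => p.
have DB t : D `&` ysection B t = D `&` [set x | c < t < g x]%R.
  apply/seteqP; split => x [Dx].
    by move/ysectionP; rewrite /B /= patchE mem_set.
  by move=> h; split=> //; apply/ysectionP; rewrite /B /= patchE mem_set.
have [e me] := @integral_sections d T m D w B mD mw w0 mB.
split; last by apply: eq_measurable_fun me => t _; rewrite DB.
under [RHS]eq_integral do rewrite -DB.
rewrite -e; apply: eq_integral => x xD.
rewrite muleC EFinM; congr *%E.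
have -> : xsection B x = `]c, g x[%classic.
  by apply/seteqP; split => t /=; rewrite xsectionE /B /= patchE xD in_itv.
rewrite lebesgue_measure_itv /= lte_fin.
by have [cg|gc] := ltP c (g x);
  [rewrite max_r ?subr_ge0 ?ltW|rewrite max_l ?subr_le0].
Qed.

(** The sections are now [[g x, c[], closed on the left so that the level sets [{g <= t}] are the
    exact complements of the sets [{t < g}]. *)
Lemma integral_head d (T : measurableType d)
    (m : {sigma_finite_measure set T -> \bar R})
    (D : set T) (w g : T -> R) (c : R) :
  measurable D -> measurable_fun D w -> (forall x, D x -> (0 <= w x)%R) ->
  measurable_fun D g ->
  \int[m]_(x in D) (Num.max 0 (c - g x) * w x)%R%:E =
  \int[mu]_t \int[m]_(x in D `&` [set x | g x <= t < c]%R) (w x)%:E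
  /\ measurable_fun setT
       (fun t => \int[m]_(x in D `&` [set x | g x <= t < c]%R) (w x)%:E).
Proof.
move=> mD mw w0 mg.
pose B := [set p : T * measurableTypeR R | ((g \_ D) p.1 <= p.2 < c)%R].
have mgD : measurable_fun setT (fun p : T * measurableTypeR R => (g \_ D) p.1).
  apply: (measurableT_comp _ measurable_fst).
  exact/(measurable_restrictT _ _).1.
have mB : measurable B.
  rewrite (_ : B = (fun p : T * measurableTypeR R =>
    ((g \_ D) p.1 <= p.2) && (p.2 < c))%R @^-1` [set true]).
    rewrite -[X in measurable X]setTI.
    apply: measurable_and => //.
      exact: measurable_fun_ler.
    exact: measurable_fun_ltr.
  by apply/seteqP; split => p.
have DB t : D `&` ysection B t = D `&` [set x | g x <= t < c]%R.
  apply/seteqP; split => x [Dx].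
    by move/ysectionP; rewrite /B /= patchE mem_set.
  by move=> h; split=> //; apply/ysectionP; rewrite /B /= patchE mem_set.
have [e me] := @integral_sections d T m D w B mD mw w0 mB.
split; last by apply: eq_measurable_fun me => t _; rewrite DB.
under [RHS]eq_integral do rewrite -DB.
rewrite -e; apply: eq_integral => x xD.
rewrite muleC EFinM; congr *%E.
have -> : xsection B x = `[g x, c[%classic.
  by apply/seteqP; split => t /=; rewrite xsectionE /B /= patchE xD in_itv.
rewrite lebesgue_measure_itv /= lte_fin.
by have [cg|gc] := ltP (g x) c;
  [rewrite max_r ?subr_ge0 ?ltW|rewrite max_l ?subr_le0].
Qed.

(** The two measure spaces may differ: this serves to compare two spectra on []0, 1[], and also [P]
    with a spectrum. *)
Lemma integral_tail_le d1 (T1 : measurableType d1)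
    (m1 : {sigma_finite_measure set T1 -> \bar R})
    (D1 : set T1) (w1 g1 : T1 -> R)
    d2 (T2 : measurableType d2)
    (m2 : {sigma_finite_measure set T2 -> \bar R})
    (D2 : set T2) (w2 g2 : T2 -> R) (c : R) :
  measurable D1 -> measurable_fun D1 w1 ->
  (forall x, D1 x -> (0 <= w1 x)%R) -> measurable_fun D1 g1 ->
  measurable D2 -> measurable_fun D2 w2 ->
  (forall x, D2 x -> (0 <= w2 x)%R) -> measurable_fun D2 g2 ->
  (forall t, (c < t)%R -> \int[m1]_(x in D1 `&` [set x | t < g1 x]%R) (w1 x)%:E
    <= \int[m2]_(x in D2 `&` [set x | t < g2 x]%R) (w2 x)%:E) ->
  \int[m1]_(x in D1) (Num.max 0 (g1 x - c) * w1 x)%R%:E <=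
  \int[m2]_(x in D2) (Num.max 0 (g2 x - c) * w2 x)%R%:E.
Proof.
move=> mD1 mw1 w10 mg1 mD2 mw2 w20 mg2 le12.
have [-> m1t] := integral_tail m1 c mD1 mw1 w10 mg1.
have [-> m2t] := integral_tail m2 c mD2 mw2 w20 mg2.
apply: ge0_le_integral => //.
- by move=> t _; apply: integral_ge0 => x [D1x _]; rewrite lee_fin w10.
- move=> t _; have [ct|tc] := ltP c t.
    exact: le12.
  (* For [t <= c] the left domain is empty and the right side is nonnegative. *)
  rewrite (_ : [set x | _] = set0).
    rewrite setI0 integral_set0.
    by apply: integral_ge0 => x [D2x _]; rewrite lee_fin w20.
  by apply/seteqP; split.
Qed.

Lemma integral_head_le d1 (T1 : measurableType d1)
    (m1 : {sigma_finite_measure set T1 -> \bar R})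
    (D1 : set T1) (w1 g1 : T1 -> R)
    d2 (T2 : measurableType d2)
    (m2 : {sigma_finite_measure set T2 -> \bar R})
    (D2 : set T2) (w2 g2 : T2 -> R) (c : R) :
  measurable D1 -> measurable_fun D1 w1 ->
  (forall x, D1 x -> (0 <= w1 x)%R) -> measurable_fun D1 g1 ->
  measurable D2 -> measurable_fun D2 w2 ->
  (forall x, D2 x -> (0 <= w2 x)%R) -> measurable_fun D2 g2 ->
  (forall t, (t < c)%R -> \int[m1]_(x in D1 `&` [set x | g1 x <= t]%R) (w1 x)%:E
    <= \int[m2]_(x in D2 `&` [set x | g2 x <= t]%R) (w2 x)%:E) ->
  \int[m1]_(x in D1) (Num.max 0 (c - g1 x) * w1 x)%R%:E <=
  \int[m2]_(x in D2) (Num.max 0 (c - g2 x) * w2 x)%R%:E.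
Proof.
move=> mD1 mw1 w10 mg1 mD2 mw2 w20 mg2 le12.
have [-> m1t] := integral_head m1 c mD1 mw1 w10 mg1.
have [-> m2t] := integral_head m2 c mD2 mw2 w20 mg2.
apply: ge0_le_integral => //.
- by move=> t _; apply: integral_ge0 => x [D1x _]; rewrite lee_fin w10.
- move=> t _; have [tc|ct] := ltP t c.
    have E U (g : U -> R) :
      [set x | (g x <= t)%R && true] = [set x | g x <= t]%R.
      by apply/seteqP; split => x /=; rewrite andbT.
    by rewrite !E; exact: le12.
  rewrite (_ : [set x | _] = set0).
    rewrite setI0 integral_set0.
    by apply: integral_ge0 => x [D2x _]; rewrite lee_fin w20.
  by apply/seteqP; split => x //=; rewrite andbF.
Qed.

End layer_cake.

(** * Measurability of monotone functions and the quantile function *)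

(** The preimage in [D] of a ray [[r, +oo[] is again an interval, hence Borel. *)
Lemma nondecreasing_itv_measurable (R : realType) (D : set R) (f : R -> R) :
  is_interval D ->
  (forall x y, D x -> D y -> x <= y -> f x <= f y) -> measurable_fun D f.
Proof.
move=> iD f_nd mD.
apply: (measurability (@RGenCInfty.G R)) mD => [|/= _ [_] [r] -> <-].
  exact: RGenCInfty.measurableE.
apply: is_interval_measurable => s t /= [Ds fs] [Dt _] u /andP[su ut].
have Du : D u by apply: (iD s t) => //; rewrite su ut.
split => //; move: fs; rewrite !in_itv /= !andbT => /le_trans; apply.
exact: f_nd.
Qed.

Section quantile.
Context d (T : measurableType d) (R : realType) (P : probability T R).
Variable X : {RV P >-> R}.

(** The Galois connection between quantile function and cdf. The limits of the cdf at both
    infinities make the infimum genuine; right-continuity makes it attained. *)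
Lemma quantile_le u t : 0 < u < 1 ->
  (quantile X u <= t) = (u%:E <= cdf X t)%E.
Proof.
move=> /andP[u0 u1].
pose A := [set x : R | (u%:E <= cdf X x)%E].
have A0 : A !=set0.
  have u1n : ereal_nbhs 1 (fun y => u%:E < y)%E.
    by apply: open_ereal_gt'; rewrite lte_fin.
  have [M [_ h]] := @cvg_cdfy1 _ _ _ _ X _ u1n.
  exists (M + 1).
  by apply/ltW/h; rewrite ltrDl.
have lA : has_lbound A.
  have u0n : ereal_nbhs 0 (fun y => y < u%:E)%E.
    by apply: open_ereal_lt'; rewrite lte_fin.
  have [M [_ h]] := @cvg_cdfNy0 _ _ _ _ X _ u0n.
  exists M => x Ax; rewrite leNgt; apply/negP => xM.
  by have := lt_le_trans (h _ xM) Ax; rewrite ltxx.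
apply/idP/idP => [qt|]; last by move=> ut; exact: ge_inf.
(* Otherwise the cdf stays below [u] at some [y] right of the infimum, although a member of [A] lies
   below [y]. *)
have uq : (u%:E <= cdf X (quantile X u))%E.
  rewrite leNgt; apply/negP => /open_ereal_lt'/cdf_right_continuous Fu.
  have {}Fu : \forall y \near (quantile X u)^'+, (cdf X y < u%:E)%E.
    exact: Fu.
  near (quantile X u)^'+ => y.
  have Fyu : (cdf X y < u%:E)%E by near: y.
  have qy : quantile X u < y by near: y; exact: nbhs_right_gt.
  have [x Ax xy] := inf_lt A0 qy.
  have := le_lt_trans (le_trans Ax (cdf_nondecreasing X (ltW xy))) Fyu.
  by rewrite ltxx.
by apply: (le_trans uq); exact: cdf_nondecreasing.
Unshelve. all: by end_near.
Qed.

Lemma quantile_gt u t : 0 < u < 1 ->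
  (t < quantile X u) = (cdf X t < u%:E)%E.
Proof. by move=> u01; rewrite ltNge quantile_le// ltNge. Qed.

Lemma measurable_quantile :
  measurable_fun (`]0, 1[%classic : set R) (quantile X).
Proof.
apply: nondecreasing_itv_measurable; first exact: interval_is_interval.
move=> x y; rewrite /= !in_itv /= => x01 y01 xy.
rewrite quantile_le//; apply: (@le_trans _ _ y%:E); first by rewrite lee_fin.
by rewrite -quantile_le.
Qed.

Lemma cdfE t : (fine (cdf X t))%:E = cdf X t.
Proof. by rewrite fineK// fin_num_measure. Qed.

Lemma fine_cdf_ge0 t : 0 <= fine (cdf X t).
Proof. by rewrite -lee_fin cdfE. Qed.

Lemma fine_cdf_le1 t : fine (cdf X t) <= 1.
Proof. by rewrite -lee_fin cdfE cdf_le1. Qed.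

Lemma quantile_gt_itv t :
  `]0, 1[ `&` [set u | t < quantile X u] = `]fine (cdf X t), 1[%classic.
Proof.
have F0 := fine_cdf_ge0 t.
apply/seteqP; split => u /=; rewrite !in_itv /=.
  by move=> [u01]; rewrite quantile_gt// -cdfE lte_fin => ->; case/andP : u01.
move=> /andP[Fu u1]; have u01 : 0 < u < 1 by rewrite (le_lt_trans F0).
by rewrite u01 quantile_gt// -cdfE lte_fin.
Qed.

End quantile.

(** * The expectile spectrum and its tail integral *)

Section expectile_spectrum.
Context (R : realType) (alpha : R).
Hypothesis halpha : 2^-1 <= alpha < 1.
Local Notation mu := (@lebesgue_measure R).
Local Notation k := (2 * alpha - 1).

(** Since [k >= 0], the expression is nonincreasing in [u], and at [u = 1] it equals
    [1 - alpha > 0]. *)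
Lemma expectile_den_gt0 (u : R) : u <= 1 -> 0 < alpha - u * k.
Proof. by case/andP : halpha => a2 a1 u1; nra. Qed.

(** By the quotient rule the numerator is [alpha (alpha - u k) - alpha (1 - u) k], which collapses
    to [alpha (1 - alpha)]. *)
Lemma is_derive_expectile_tail (u : R) : u <= 1 ->
  is_derive u 1 (fun u : R => - (alpha * (1 - u) / (alpha - u * k)))
    (expectile_spectrum alpha u).
Proof.
move=> u1; have d0 := expectile_den_gt0 u1.
have dD : is_derive u 1 (cst alpha - id * cst k : R -> R) (- k).
  by apply: is_derive_eq; rewrite scaler0 !add0r /GRing.scale /= mulr1.
have dN : is_derive u 1 (cst alpha * (cst 1 - id) : R -> R) (- alpha).
  by apply: is_derive_eq; rewrite scaler0 addr0 sub0r /GRing.scale /= mulrN1.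
have dV := @is_deriveV R (cst alpha - id * cst k) u _ _ (lt0r_neq0 d0) dD.
have dG := is_deriveN (is_deriveM dN dV).
refine (is_derive_eq dG _).
rewrite /GRing.scale /= /expectile_spectrum.
have -> : (cst alpha - id * cst k) u = alpha - u * k by [].
have -> : (cst alpha * (cst 1 - id)) u = alpha * (1 - u) by [].
field.
by rewrite gt_eqF.
Qed.

Lemma continuous_expectile_spectrum (u : R) : u <= 1 ->
  {for u, continuous (expectile_spectrum alpha)}.
Proof.
move=> u1; have d0 := expectile_den_gt0 u1.
apply: cvgM; first exact: cvg_cst.
apply: cvgV; first by rewrite expf_neq0// gt_eqF.
have -> : (fun u : R => (alpha - u * k) ^+ 2) =
    (fun u => (alpha - u * k) * (alpha - u * k)).
  by apply/funext => x; rewrite expr2.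
rewrite expr2; apply: cvgM; apply: cvgB; do ?exact: cvg_cst.
all: by apply: cvgM; [exact: cvg_id|exact: cvg_cst].
Qed.

Lemma measurable_expectile_spectrum :
  measurable_fun (`]0, 1[%classic : set R) (expectile_spectrum alpha).
Proof.
apply: open_continuous_measurable_fun; first exact: interval_open.
move=> u; rewrite inE /= in_itv /= => /andP[_ /ltW].
exact: continuous_expectile_spectrum.
Qed.

Lemma integral_expectile_spectrum_tail v : 0 <= v <= 1 ->
  (\int[mu]_(u in `]v, 1%R[) (expectile_spectrum alpha u)%:E =
   (alpha * (1 - v) / (alpha - v * k))%:E)%E.
Proof.
move=> /andP[v0]; rewrite le_eqVlt => /predU1P[->|v1].
  by rewrite set_itvoo0 integral_set0 subrr mulr0 mul0r.
pose G (u : R) := - (alpha * (1 - u) / (alpha - u * k)).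
(* Adding the two null endpoints gives the closed interval on which the fundamental theorem of
   calculus is applied. *)
rewrite -(@integral_itv_bndoo _ _ _ _ true false); last first.
  apply/measurable_EFinP.
  apply: measurable_funS measurable_expectile_spectrum => //.
  by apply: subset_itv => //; rewrite bnd_simp.
rewrite (@continuous_FTC2 _ _ G)//.
- by rewrite /G subrr mulr0 mul0r oppr0 -EFinB sub0r opprK.
- apply: continuous_in_subspaceT => u; rewrite inE /= in_itv /= => /andP[_].
  exact: continuous_expectile_spectrum.
- have cG u : u <= 1 -> {for u, continuous G}.
    move=> u1; apply/differentiable_continuous/derivable1_diffP.
    by have [] := is_derive_expectile_tail u1.
  split.
  + move=> u; rewrite in_itv /= => /andP[_ /ltW u1].
    by have [] := is_derive_expectile_tail u1.
  + by apply: cvg_at_right_filter; apply: cG; exact: ltW.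
  + by apply: cvg_at_left_filter; exact: cG.
- move=> u; rewrite in_itv /= => /andP[_ /ltW u1].
  by rewrite derive1E; have [] := is_derive_expectile_tail u1.
Qed.

Lemma is_spectrum_expectile_spectrum : is_spectrum (expectile_spectrum alpha).
Proof.
have /andP[a2 a1] := halpha.
split.
- move=> u; rewrite in_itv /= => /andP[_ /ltW u1].
  have := expectile_den_gt0 u1.
  by move=> d0; apply: divr_ge0; [nra|exact/exprn_ge0/ltW].
- move=> u v; rewrite !in_itv /= => /andP[_ /ltW u1] /andP[_ /ltW v1] uv.
  have du := expectile_den_gt0 u1; have dv := expectile_den_gt0 v1.
  rewrite /expectile_spectrum ler_wpM2l//; first by nra.
  rewrite lef_pV2 ?posrE ?exprn_gt0// ler_sqr ?nnegrE; [|exact: ltW..].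
  by rewrite lerD2l lerN2 ler_wpM2r//; lra.
(* The point 0 is null, so the total mass is the tail integral at [v = 0], that is
   [alpha / alpha]. *)
- rewrite (integral_itv_bndoo (f := EFin \o _)).
    rewrite integral_expectile_spectrum_tail ?lexx ?ler01//.
    by congr EFin; field; lra.
  by apply/measurable_EFinP; exact: measurable_expectile_spectrum.
Qed.

End expectile_spectrum.

(** * Spectral risk in terms of the tail masses of the spectrum *)

Section spectral_risk.
Context (R : realType) (sigma : R -> R).
Hypothesis hsigma : is_spectrum sigma.
Local Notation mu := (@lebesgue_measure R).
Local Notation I01 := (`]0, 1[%classic : set R).

Let I01_co u : I01 u -> u \in `[0, 1[.
Proof. by rewrite /= !in_itv /= => /andP[/ltW -> ->]. Qed.

Lemma spectrum_ge0 u : I01 u -> 0 <= sigma u.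
Proof. by case: hsigma => s0 _ _ /I01_co; exact: s0. Qed.

Lemma measurable_spectrum : measurable_fun I01 sigma.
Proof.
case: hsigma => _ nd_sigma _.
apply: nondecreasing_itv_measurable; first exact: interval_is_interval.
by move=> x y /I01_co x01 /I01_co y01; exact: nd_sigma.
Qed.

Lemma integral_spectrum : (\int[mu]_(u in I01) (sigma u)%:E = 1)%E.
Proof.
case: hsigma => _ _ <-.
rewrite [RHS](integral_itv_bndoo (f := EFin \o sigma))//.
by apply/measurable_EFinP; exact: measurable_spectrum.
Qed.

Context d (T : measurableType d) (P : probability T R).
Variable X : {RV P >-> R}.

Lemma integral_spectrum_split t :
  (\int[mu]_(u in I01 `&` [set u | quantile X u <= t]%R) (sigma u)%:E +
   \int[mu]_(u in `](fine (cdf X t)), 1%R[) (sigma u)%:E = 1)%E.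
Proof.
have mq := measurable_quantile X.
have mle : measurable (I01 `&` [set u | quantile X u <= t]).
  rewrite (_ : [set u | _] = quantile X @^-1` `]-oo, t]); first exact: mq.
  by apply/seteqP; split => u; rewrite /= in_itv.
have E : I01 `&` [set u | quantile X u <= t] `|`
    `]fine (cdf X t), 1[%classic = I01.
  rewrite -quantile_gt_itv -setIUr; apply/setIidPl => u _ /=.
  by case: (leP (quantile X u) t); [left|right].
rewrite -integral_spectrum -[in RHS]E ge0_integral_setU//.
- by rewrite E; apply/measurable_EFinP; exact: measurable_spectrum.
- by rewrite E => u /spectrum_ge0; rewrite lee_fin.
- rewrite -quantile_gt_itv; apply/disj_setPS => u /= [[_ h] [_]].
  by rewrite ltNge h.
Qed.

Lemma integral_spectrum_tail_le1 v : 0 <= v ->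
  (0 <= \int[mu]_(u in `]v, 1%R[) (sigma u)%:E <= 1)%E.
Proof.
move=> v0; have sub : `]v, 1[%classic `<=` I01.
  by move=> u /=; rewrite !in_itv /= => /andP[vu ->]; rewrite (le_lt_trans v0).
apply/andP; split.
  by apply: integral_ge0 => u /sub/spectrum_ge0; rewrite lee_fin.
rewrite -integral_spectrum; apply: ge0_subset_integral => //.
  by apply/measurable_EFinP; exact: measurable_spectrum.
by move=> u /spectrum_ge0; rewrite lee_fin.
Qed.

(** Head and tail split the total mass 1; the tail mass is at most 1, hence finite and
    cancellable. *)
Lemma integral_spectrum_head t :
  (\int[mu]_(u in I01 `&` [set u | quantile X u <= t]%R) (sigma u)%:E =
   1 - \int[mu]_(u in `](fine (cdf X t)), 1%R[) (sigma u)%:E)%E.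
Proof.
have /andP[s0 s1] := integral_spectrum_tail_le1 (fine_cdf_ge0 X t).
rewrite -(integral_spectrum_split t) addeK//.
by rewrite ge0_fin_numE// (le_lt_trans s1) ?ltry.
Qed.

(** As [sigma >= 0], it factors out of the positive and negative parts. The differences with 0 are
    kept to match the layer-cake formulas at level [c = 0]. *)
Lemma spectral_riskE : spectral_risk sigma X =
  (\int[mu]_(u in I01) (Num.max 0 (quantile X u - 0) * sigma u)%R%:E -
   \int[mu]_(u in I01) (Num.max 0 (0 - quantile X u) * sigma u)%R%:E)%E.
Proof.
rewrite /spectral_risk integralE; congr (_ - _)%E; apply: eq_integral => u.
  rewrite inE => /spectrum_ge0 s0.
  rewrite funeposE -EFin_max; congr EFin.
  by rewrite subr0 maxr_pMl// mul0r maxC.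
rewrite inE => /spectrum_ge0 s0.
rewrite funenegE -EFinN -mulNr -EFin_max; congr EFin.
by rewrite sub0r maxr_pMl// mul0r maxC.
Qed.

End spectral_risk.

(* Both integrals may be infinite: the positive and the negative parts are
   compared separately, and subtraction on the extended reals is monotone. *)
Lemma spectral_risk_le (R : realType) (sigma1 sigma2 : R -> R)
    d (T : measurableType d) (P : probability T R) (X : {RV P >-> R}) :
  is_spectrum sigma1 -> is_spectrum sigma2 ->
  (forall t,
    \int[@lebesgue_measure R]_(u in `](fine (cdf X t)), 1%R[) (sigma1 u)%:E <=
    \int[@lebesgue_measure R]_(u in `](fine (cdf X t)), 1%R[) (sigma2 u)%:E
  )%E ->
  (spectral_risk sigma1 X <= spectral_risk sigma2 X)%E.
Proof.
move=> s1 s2 le12; rewrite (spectral_riskE s1) (spectral_riskE s2).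
have mq := measurable_quantile X.
have m1 := measurable_spectrum s1; have m2 := measurable_spectrum s2.
apply: leeB.
  apply: integral_tail_le => //; [exact: spectrum_ge0|exact: spectrum_ge0|].
  by move=> t _; rewrite quantile_gt_itv.
apply: integral_head_le => //; [exact: spectrum_ge0|exact: spectrum_ge0|].
by move=> t _; rewrite !integral_spectrum_head//; exact: leeB.
Qed.

(** * Existence and defining equation of the expectile *)

Section expectile.
Context d (T : measurableType d) (R : realType) (P : probability T R).
Variable X : {RV P >-> R}.
Local Notation Epos x := 'E_P[(fun w => Num.max 0 (X w - x))%R]%E.
Local Notation Eneg x := 'E_P[(fun w => Num.max 0 (x - X w))%R]%E.
Hypothesis X1 : (X : T -> R) \in Lfun P 1.


Let measurable_excess x : measurable_fun setT (fun w => Num.max 0 (X w - x)).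
Proof. by apply: measurable_maxr => //; exact: measurable_funB. Qed.

Lemma Lfun_excess x : (fun w => Num.max 0 (X w - x)) \in Lfun P 1.
Proof.
have -> : (fun w => Num.max 0 (X w - x)) = (X \- cst x)^\+.
  by apply/funext => w; rewrite /funrpos maxC.
apply/Lfun1_integrable/integrable_funrpos => //; apply/Lfun1_integrable.
by rewrite rpredB// Lfun_cst.
Qed.

Lemma Lfun_shortfall x : (fun w => Num.max 0 (x - X w)) \in Lfun P 1.
Proof.
have -> : (fun w => Num.max 0 (x - X w)) = (X \- cst x)^\-.
  by apply/funext => w; rewrite /funrneg maxC opprB.
apply/Lfun1_integrable/integrable_funrneg => //; apply/Lfun1_integrable.
by rewrite rpredB// Lfun_cst.
Qed.

(** Positive minus negative part of [X - x]; this eliminates the shortfall from the expectile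
    equation. *)
Lemma expectation_excessB x :
  fine (Epos x) - fine (Eneg x)
  = fine 'E_P[X] - x.
Proof.
have h : ((Epos x - Eneg x)
   = 'E_P[X] - x%:E)%E.
  rewrite -(expectation_cst P x).
  rewrite -!expectationB ?Lfun_excess ?Lfun_shortfall ?Lfun_cst//.
  congr expectation; apply/funext => w /=.
  by case: leP => ?; case: leP => ?; lra.
apply: EFin_inj; rewrite !EFinB.
by rewrite !fineK ?expectation_fin_num ?Lfun_excess ?Lfun_shortfall.
Qed.

(** The excess is 1-Lipschitz in the level, pointwise; this gives continuity of its expectation. *)
Lemma expectation_excess_le x y :
  fine (Epos x) <=
  fine (Epos y) + `|x - y|.
Proof.
rewrite -lee_fin EFinD !fineK ?expectation_fin_num ?Lfun_excess//.
rewrite -(expectation_cst P `|x - y|) -expectationD ?Lfun_excess ?Lfun_cst//.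
apply: expectation_le.
- exact: measurable_excess.
- by apply: measurable_funD => //; exact: measurable_excess.
- by move=> w; rewrite le_max lexx.
- by move=> w /=; rewrite addr_ge0// le_max lexx.
- apply/aeW => w /=.
  have := ler_norm (y - x); rewrite distrC => h.
  rewrite ge_max addr_ge0 ?le_max ?lexx//=.
  have : X w - y <= Num.max 0 (X w - y) by rewrite le_max lexx orbT.
  by move: h; lra.
Qed.

Lemma continuous_expectation_excess :
  continuous (fun x => fine (Epos x)).
Proof.
move=> x; apply/cvgrPdist_le => e e0; near=> y.
have xy : `|x - y| <= e by near: y; exact: cvgr_dist_le.
have h1 := expectation_excess_le x y.
have := expectation_excess_le y x; rewrite (distrC y) => h2.
by rewrite ler_norml; apply/andP; split; lra.
Unshelve. all: by end_near.
Qed.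

Lemma expectile_exists alpha : 2^-1 <= alpha < 1 -> exists x : R,
  alpha * fine (Epos x) =
  (1 - alpha) * fine (Eneg x).
Proof.
move=> /andP[a2 a1].
pose f x := fine (Epos x).
pose m := fine 'E_P[X].
(* The difference of the two sides, once the shortfall is replaced by [f x - (m - x)]; a zero comes
   from the intermediate value theorem. *)
pose h x := (1 - alpha) * (m - x) + (2 * alpha - 1) * f x.
have f0 x : 0 <= f x.
  by apply: fine_ge0; apply: expectation_ge0 => w; rewrite le_max lexx.
suff [x hx] : exists x, h x = 0.
  exists x; have := expectation_excessB x; rewrite -/(f x) -/m => fB.
  have -> : fine (Eneg x) = f x - (m - x) by rewrite -fB subKr.
  by apply/eqP; rewrite -subr_eq0 -hx; apply/eqP; rewrite /h; ring.
have ch : continuous h.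
  move=> x; apply: cvgD.
    apply: cvgM; first exact: cvg_cst.
    by apply: cvgB; [exact: cvg_cst|exact: cvg_id].
  apply: cvgM; first exact: cvg_cst.
  exact: continuous_expectation_excess.
(* Chosen so that [(1 - alpha) (m - b)] cancels [(2 alpha - 1) f m]; as [f] is nonincreasing,
   [h b <= 0]. *)
pose b := m + (2 * alpha - 1) / (1 - alpha) * f m.
have mb : m <= b by rewrite lerDl mulr_ge0// divr_ge0//; lra.
have fb : f b <= f m.
  rewrite -lee_fin !fineK ?expectation_fin_num ?Lfun_excess//.
  apply: expectation_le.
  - exact: measurable_excess.
  - exact: measurable_excess.
  - by move=> w; rewrite le_max lexx.
  - by move=> w; rewrite le_max lexx.
  - by apply/aeW => w /=; rewrite ge_max !le_max lexx/= lerD2l lerN2 mb orbT.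
have hm : 0 <= h m by rewrite /h subrr mulr0 add0r mulr_ge0//; lra.
have hb : h b <= 0.
  have -> : h b = (2 * alpha - 1) * (f b - f m).
    by rewrite /h /b; field; lra.
  by rewrite mulr_ge0_le0//; lra.
have [||c _ hc] := @IVT R h m b 0 mb; last by exists c.
  exact: continuous_subspaceT.
by rewrite ge_min hb orbT le_max hm.
Qed.

(** Existence excludes the default value of [xget]; both expectations are finite, so the equation
    can be read in the reals. *)
Lemma expectileP alpha : 2^-1 <= alpha < 1 ->
  alpha * fine (Epos (expectile alpha X)) =
  (1 - alpha) * fine (Eneg (expectile alpha X)).
Proof.
move=> ha; have [x hx] := expectile_exists ha.
have : (alpha%:E * Epos (expectile alpha X) =
    (1 - alpha)%:E * Eneg (expectile alpha X))%E.
  apply: (@xgetPex _ 0 [set x : R |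
    (alpha%:E * Epos x = (1 - alpha)%:E * Eneg x)%E]).
  exists x => /=.
  rewrite -[Epos x]fineK ?expectation_fin_num ?Lfun_excess//.
  rewrite -[Eneg x]fineK ?expectation_fin_num ?Lfun_shortfall//.
  by rewrite -!EFinM hx.
move/(congr1 fine).
by rewrite !fineM ?expectation_fin_num ?Lfun_excess ?Lfun_shortfall.
Qed.

End expectile.

(** * Domination of the expectile by [s_alpha] *)

Lemma ge0_integrable_EFin d (T : measurableType d) (R : realType)
    (m : {measure set T -> \bar R}) (D : set T) (f : T -> R) :
  measurable D -> measurable_fun D f -> (forall x, D x -> 0 <= f x) ->
  (\int[m]_(x in D) (f x)%:E < +oo)%E -> m.-integrable D (EFin \o f).
Proof.
move=> mD mf f0 foo; apply/integrableP; split; first exact/measurable_EFinP.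
rewrite (_ : (\int[m]_(x in D) _)%E = (\int[m]_(x in D) (f x)%:E)%E)//.
by apply: eq_integral => x; rewrite inE => /f0 fx; rewrite gee0_abs// lee_fin.
Qed.

Section expectile_le.
Context d (T : measurableType d) (R : realType) (P : probability T R).
Variable X : {RV P >-> R}.
Hypothesis X1 : (X : T -> R) \in Lfun P 1.
Local Notation mu := (@lebesgue_measure R).
Local Notation I01 := (`]0, 1[%classic : set R).
Local Notation Epos x := 'E_P[(fun w => Num.max 0 (X w - x))%R]%E.
Local Notation Eneg x := 'E_P[(fun w => Num.max 0 (x - X w))%R]%E.
Local Notation F t := (fine (cdf X t)).

(** Tail mass of [X] for the constant weight [c], to be compared with the tail mass of the spectrum
    at [F t]. *)
Lemma integral_cst_gt (c t : R) :
  (\int[P]_(w in setT `&` [set w | t < X w]%R) c%:E = (c * (1 - F t))%R%:E)%E.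
Proof.
rewrite setTI integral_cst; last first.
  by rewrite (_ : [set w | _] = X @^-1` `]t, +oo[); [exact: measurable_funPTI|
     apply/seteqP; split => w; rewrite /= in_itv/= andbT].
rewrite EFinM; congr (_ * _)%E.
rewrite EFinB cdfE -ccdf_1_cdf /ccdf /= /pushforward.
by congr (P _); apply/seteqP; split => w; rewrite /= in_itv/= andbT.
Qed.

Lemma integral_cst_le (c t : R) :
  (\int[P]_(w in setT `&` [set w | X w <= t]%R) c%:E = (c * F t)%R%:E)%E.
Proof.
have E : [set w | X w <= t] = X @^-1` `]-oo, t].
  by apply/seteqP; split => w; rewrite /= in_itv.
rewrite setTI E integral_cst; last exact: measurable_funPTI.
by rewrite EFinM cdfE.
Qed.

Lemma integral_excess_cst (c x : R) : 0 <= c ->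
  (\int[P]_w (Num.max 0 (X w - x) * c)%R%:E = c%:E * Epos x)%E.
Proof.
move=> c0; rewrite unlock muleC -ge0_integralZr//.
- by apply/measurable_EFinP/measurable_maxr => //; exact: measurable_funB.
- by move=> w _; rewrite lee_fin le_max lexx.
Qed.

Lemma integral_shortfall_cst (c x : R) : 0 <= c ->
  (\int[P]_w (Num.max 0 (x - X w) * c)%R%:E = c%:E * Eneg x)%E.
Proof.
move=> c0; rewrite unlock muleC -ge0_integralZr//.
- by apply/measurable_EFinP/measurable_maxr => //; exact: measurable_funB.
- by move=> w _; rewrite lee_fin le_max lexx.
Qed.

Variable alpha : R.
Hypothesis halpha : 2^-1 <= alpha < 1.
Local Notation k := (2 * alpha - 1).
Local Notation sigma := (expectile_spectrum alpha).

Lemma expectile_le_s_alpha : ((expectile alpha X)%:E <= s_alpha alpha X)%E.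
Proof.
have /andP[a2 a1] := halpha.
set x := expectile alpha X.
have hs := is_spectrum_expectile_spectrum halpha.
have ms := measurable_spectrum hs.
have s0 := spectrum_ge0 hs.
have mq := measurable_quantile X.
have F01 t : 0 <= F t <= 1 by rewrite fine_cdf_ge0 fine_cdf_le1.
have Fmono s t : s <= t -> F s <= F t.
  by move=> st; rewrite -lee_fin !cdfE; exact: cdf_nondecreasing.
have den0 t : 0 < alpha - F t * k.
  by apply: expectile_den_gt0 => //; exact: fine_cdf_le1.
pose N := alpha - F x * k.
have N0 : 0 < N := den0 x.
(* [A] and [B] are the weighted parts of the quantile function above and below [x]; the goal becomes
   [B <= A] once [s_alpha] is written as [x + (A - B)]. *)
pose A := (\int[mu]_(u in I01) (Num.max 0 (quantile X u - x) * sigma u)%R%:E)%E.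
pose B := (\int[mu]_(u in I01) (Num.max 0 (x - quantile X u) * sigma u)%R%:E)%E.
have A0 : (0 <= A)%E.
  apply: integral_ge0 => u /s0 su; rewrite lee_fin mulr_ge0//.
  by rewrite le_max lexx.
have B0 : (0 <= B)%E.
  apply: integral_ge0 => u /s0 su; rewrite lee_fin mulr_ge0//.
  by rewrite le_max lexx.
(* For [t > x] the denominator at [F t] is at most [N], since [F x <= F t]. *)
have pA : ((alpha / N)%:E * Epos x <= A)%E.
  rewrite -integral_excess_cst; last by rewrite divr_ge0 ?ltW//; lra.
  apply: integral_tail_le => //.
  - by move=> w _; rewrite divr_ge0 ?ltW//; lra.
  - move=> t xt; rewrite integral_cst_gt quantile_gt_itv.
    rewrite integral_expectile_spectrum_tail// lee_fin mulrAC.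
    have /andP[F0 F1] := F01 t.
    rewrite ler_wpM2l ?mulr_ge0//; [lra|lra|].
    rewrite lef_pV2 ?posrE//; have := Fmono _ _ (ltW xt).
    by rewrite /N; nra.
(* This bound serves finiteness of [A]: every denominator is at least [1 - alpha]. *)
have Ap : (A <= (alpha / (1 - alpha))%:E * Epos x)%E.
  rewrite -integral_excess_cst; last by rewrite divr_ge0//; lra.
  apply: integral_tail_le => //.
  - by move=> w _; rewrite divr_ge0//; lra.
  - move=> t xt; rewrite integral_cst_gt quantile_gt_itv.
    rewrite integral_expectile_spectrum_tail// lee_fin [leRHS]mulrAC.
    have /andP[F0 F1] := F01 t.
    rewrite ler_wpM2l ?mulr_ge0//; [lra|lra|].
    by rewrite lef_pV2 ?posrE//; [nra|lra].
(* For [t < x] the denominator at [F t] is at least [N], and the head mass there is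
   [(1 - alpha) F t] over that denominator. *)
have Bn : (B <= ((1 - alpha) / N)%:E * Eneg x)%E.
  rewrite -integral_shortfall_cst; last by rewrite divr_ge0 ?ltW//; lra.
  apply: integral_head_le => //.
  - by move=> w _; rewrite divr_ge0 ?ltW//; lra.
  - move=> t tx; rewrite integral_cst_le integral_spectrum_head//.
    rewrite integral_expectile_spectrum_tail// -EFinB lee_fin.
    have /andP[F0 F1] := F01 t.
    have -> : 1 - alpha * (1 - F t) / (alpha - F t * k) =
        (1 - alpha) * F t / (alpha - F t * k).
      by field; rewrite gt_eqF.
    rewrite [leRHS]mulrAC ler_wpM2l ?mulr_ge0//; [lra|].
    rewrite lef_pV2 ?posrE//; have := Fmono _ _ (ltW tx).
    by rewrite /N; nra.
have eP := expectileP X1 halpha; rewrite -/x in eP.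
have Pfin : Epos x \is a fin_num by rewrite expectation_fin_num ?Lfun_excess.
have Nfin : Eneg x \is a fin_num by rewrite expectation_fin_num ?Lfun_shortfall.
(* By the expectile equation the upper bound of [B] equals the lower bound of [A]. *)
have AB : (B <= A)%E.
  apply: (le_trans Bn); apply: le_trans pA.
  rewrite -(fineK Pfin) -(fineK Nfin) -!EFinM lee_fin.
  by rewrite mulrAC -eP mulrAC.
have Afin : (A < +oo)%E.
  by apply: (le_lt_trans Ap); rewrite -(fineK Pfin) -EFinM ltry.
have Bfin : (B < +oo)%E by exact: le_lt_trans Afin.
have mA : measurable_fun I01 (fun u => Num.max 0 (quantile X u - x) * sigma u).
  apply: measurable_funM => //; apply: measurable_maxr => //.
  exact: measurable_funB.
have mB : measurable_fun I01 (fun u => Num.max 0 (x - quantile X u) * sigma u).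
  apply: measurable_funM => //; apply: measurable_maxr => //.
  exact: measurable_funB.
have iA : mu.-integrable I01
    (EFin \o (fun u => Num.max 0 (quantile X u - x) * sigma u)).
  apply: ge0_integrable_EFin => // u /s0 su; rewrite mulr_ge0//.
  by rewrite le_max lexx.
have iB : mu.-integrable I01
    (EFin \o (fun u => Num.max 0 (x - quantile X u) * sigma u)).
  apply: ge0_integrable_EFin => // u /s0 su; rewrite mulr_ge0//.
  by rewrite le_max lexx.
have is1 : mu.-integrable I01 (EFin \o sigma).
  by apply: ge0_integrable_EFin => //; rewrite (integral_spectrum hs) ltry.
(* The spectrum has mass 1, so [x] is the integral of [x sigma]; pointwise,
   [q = x + max 0 (q - x) - max 0 (x - q)]. *)
have -> : s_alpha alpha X = (x%:E + (A - B))%E.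
  rewrite /A /B -integralB_EFin//.
  have xs : (x%:E = \int[mu]_(u in I01) (x%:E * (sigma u)%:E))%E.
    by rewrite integralZl// (integral_spectrum hs) mule1.
  rewrite {1}xs -integralD//.
  - rewrite /s_alpha; apply: eq_integral => u _.
    rewrite /= -EFinM -EFinB -EFinD; congr EFin.
    rewrite -mulrBl -mulrDl; congr (_ * _).
    have [?|?] := leP 0 (quantile X u - x);
      by have [?|?] := leP 0 (x - quantile X u); lra.
  - exact: integrableZl.
  - exact: integrableB.
by rewrite leeDl// sube_ge0// ?ge0_fin_numE ?Bfin.
Qed.

End expectile_le.

(** * Quantile, spectral risk and expectile of an indicator *)

Section indicator.
Context d (T : measurableType d) (R : realType) (P : probability T R).
Variables (A : set T) (mA : measurable A).
Local Notation mu := (@lebesgue_measure R).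
Local Notation I01 := (`]0, 1[%classic : set R).
Local Notation X := (indic_mfun A mA : {RV P >-> R}).
Local Notation p := (fine (P A)).

Let PAE : P A = p%:E.
Proof. by rewrite fineK// fin_num_measure. Qed.

Let p01 : 0 <= p <= 1.
Proof. by rewrite -!lee_fin -PAE measure_ge0 probability_le1. Qed.

Lemma Lfun_indic_mfun : (X : T -> R) \in Lfun P 1.
Proof.
by apply/Lfun1_integrable; exact: integrable_indic.
Qed.

Lemma cdf_indic_lt1 r : 0 <= r < 1 -> cdf X r = (1 - p)%:E.
Proof.
move=> /andP[r0 r1]; rewrite EFinB -PAE -probability_setC//.
congr (P _); apply/seteqP; split => w /=; rewrite in_itv /= /mindic indicE.
  case: (boolP (w \in A)) => [|/negP wA _ Aw]; first by rewrite leNgt r1.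
  exact/wA/mem_set.
by move=> wA; rewrite memNset.
Qed.

Lemma cdf_indic_lt0 r : r < 0 -> cdf X r = 0%E.
Proof.
move=> r0; rewrite -(measure0 P); congr (P _).
apply/seteqP; split => w //=; rewrite in_itv /= /mindic indicE leNgt.
by rewrite (lt_le_trans r0).
Qed.

Lemma cdf_indic_ge1 r : 1 <= r -> cdf X r = 1%E.
Proof.
move=> r1; rewrite -(probability_setT P); congr (P _).
apply/seteqP; split => w //= _; rewrite in_itv /= /mindic indicE.
by apply: le_trans r1; case: (w \in A).
Qed.

Lemma quantile_indic u : 0 < u < 1 -> quantile X u = \1_`]1 - p, 1[ u.
Proof.
move=> u01; have /andP[u0 u1] := u01; have /andP[p0 p1] := p01.
have q0 : 0 <= quantile X u.
  rewrite leNgt; apply/negP => q0.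
  have := quantile_le X (quantile X u) u01; rewrite lexx cdf_indic_lt0//.
  by rewrite lee_fin leNgt u0.
rewrite indicE; have [pu|up] := ltP (1 - p) u.
  rewrite mem_set /= ?in_itv/= ?pu//; apply/eqP; rewrite eq_le.
  rewrite quantile_le// cdf_indic_ge1// lee_fin (ltW u1)/=.
  rewrite leNgt; apply/negP => q1.
  (* Taking the quantile itself as level gives [u <= cdf X (quantile X u)]; a quantile in [[0, 1[]
     would force [u <= 1 - p]. *)
  have := quantile_le X (quantile X u) u01; rewrite lexx cdf_indic_lt1 ?q0//.
  by rewrite lee_fin leNgt pu.
rewrite memNset /= ?in_itv/= ?ltNge ?up//; apply/eqP; rewrite eq_le q0 andbT.
by rewrite quantile_le// cdf_indic_lt1 ?lexx ?ltr01// lee_fin.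
Qed.

Lemma spectral_risk_indic sigma :
  spectral_risk sigma X = (\int[mu]_(u in `](1 - p)%R, 1%R[) (sigma u)%:E)%E.
Proof.
have /andP[p0 p1] := p01.
rewrite (_ : `]1 - p, 1[%classic = I01 `&` `]1 - p, 1[%classic); last first.
  apply/esym/setIidPr => u /=; rewrite !in_itv /= => /andP[pu ->].
  by rewrite (le_lt_trans _ pu)//; lra.
rewrite integral_mkcondr; apply: eq_integral => u.
rewrite inE /= in_itv /= => u01.
rewrite quantile_indic// patchE indicE.
by case: ifPn; rewrite ?mul1r ?mul0r.
Qed.

(** For [0 <= x <= 1] the equation reads [alpha (1 - x) p = (1 - alpha) x (1 - p)]; the denominator
    is [alpha p + (1 - alpha) (1 - p)]. *)
Lemma expectile_indic alpha : 2^-1 <= alpha < 1 ->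
  expectile alpha X = alpha * p / (alpha - (1 - p) * (2 * alpha - 1)).
Proof.
move=> ha; have /andP[a2 a1] := ha; have /andP[p0 p1] := p01.
have den0 : 0 < alpha - (1 - p) * (2 * alpha - 1).
  by apply: expectile_den_gt0 => //; lra.
(* Expectation of a function equal to [a] off [A] and to [b] on [A]. *)
have E (f : T -> R) (a b : R) : f = (fun w => a + (b - a) * \1_A w) ->
    fine 'E_P[f] = a * (1 - p) + b * p.
  move=> ->.
  have A1 : (\1_A : T -> R) \in Lfun P 1 by exact: Lfun_indic_mfun.
  have -> : (fun w => a + (b - a) * \1_A w) = cst a \+ (b - a) \o* \1_A.
    by apply/funext => w; rewrite /= [in RHS]mulrC.
  rewrite expectationD ?Lfun_cst ?Lfun_scale// expectation_cst expectationZl//.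
  by rewrite expectation_indic// PAE -EFinM -EFinD /=; ring.
have := expectileP Lfun_indic_mfun ha.
set x := expectile alpha X.
rewrite (E _ (Num.max 0 (- x)) (Num.max 0 (1 - x))); last first.
  apply/funext => w; rewrite /= /mindic !indicE.
  by case: (w \in A); rewrite ?mulr1 ?mulr0 ?sub0r ?addr0 ?subrKC.
rewrite (E _ (Num.max 0 x) (Num.max 0 (x - 1))); last first.
  apply/funext => w; rewrite /= /mindic !indicE.
  by case: (w \in A); rewrite ?mulr1 ?mulr0 ?subr0 ?addr0 ?subrKC.
move=> e; rewrite -[LHS](mulfK (lt0r_neq0 den0)); congr (_ / _).
(* Outside [[0, 1]] one side of [e] vanishes while the other is positive, so only the last case
   survives. *)
have [x0|x0] := ltP x 0.
  have e1 : Num.max 0 (- x) = - x by apply: max_r; lra.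
  have e2 : Num.max 0 (1 - x) = 1 - x by apply: max_r; lra.
  have e3 : Num.max 0 x = 0 by apply: max_l; lra.
  have e4 : Num.max 0 (x - 1) = 0 by apply: max_l; lra.
  by move: e; rewrite e1 e2 e3 e4; nra.
have [x1|x1] := ltP 1 x.
  have e1 : Num.max 0 (- x) = 0 by apply: max_l; lra.
  have e2 : Num.max 0 (1 - x) = 0 by apply: max_l; lra.
  have e3 : Num.max 0 x = x by apply: max_r; lra.
  have e4 : Num.max 0 (x - 1) = x - 1 by apply: max_r; lra.
  by move: e; rewrite e1 e2 e3 e4; nra.
have e1 : Num.max 0 (- x) = 0 by apply: max_l; lra.
have e2 : Num.max 0 (1 - x) = 1 - x by apply: max_r; lra.
have e3 : Num.max 0 x = x by apply: max_r; lra.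
have e4 : Num.max 0 (x - 1) = 0 by apply: max_l; lra.
by move: e; rewrite e1 e2 e3 e4; lra.
Qed.

End indicator.

(** * Minimality, by testing on indicators of upper level sets *)

Theorem proposition2p5 (d : measure_display) (T : measurableType d)
    (R : realType) (P : probability T R) (alpha : R)
    (halpha : 2^-1 <= alpha < 1) :
  [/\ is_spectral_risk_measure (P := P) (expectile_spectrum alpha) (s_alpha alpha),
      forall X : {RV P >-> R}, (X : T -> R) \in Lfun P 1 ->
        ((expectile alpha X)%:E <= s_alpha alpha X)%E &
      forall (sigma : R -> R) (rho : {RV P >-> R} -> \bar R),
        is_spectral_risk_measure sigma rho ->
        (forall X : {RV P >-> R}, (X : T -> R) \in Lfun P 1 ->
           ((expectile alpha X)%:E <= rho X)%E) ->
        forall X : {RV P >-> R}, (X : T -> R) \in Lfun P 1 ->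
          ((expectile alpha X)%:E <= s_alpha alpha X <= rho X)%E].
Proof.
have hs := is_spectrum_expectile_spectrum halpha.
split=> [|X X1|sigma rho [hsigma hrho] e_le X X1]; first by split.
  exact: expectile_le_s_alpha.
rewrite expectile_le_s_alpha//= hrho//; apply: spectral_risk_le => // t.
have F01 : 0 <= fine (cdf X t) <= 1 by rewrite fine_cdf_ge0 fine_cdf_le1.
(* The indicator of [A] lives on the same probability space and [1 - P A = F t], so testing [rho] on
   it gives the tail inequality at exactly the point required. *)
pose A := X @^-1` `]t, +oo[.
have mA : measurable A by exact: measurable_funPTI.
have PA : fine (P A) = 1 - fine (cdf X t).
  by apply: EFin_inj; rewrite EFinB cdfE -ccdf_1_cdf fineK// fin_num_measure.
have := e_le (indic_mfun A mA) (Lfun_indic_mfun P mA).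
rewrite hrho ?Lfun_indic_mfun// spectral_risk_indic expectile_indic//.
by rewrite PA subKr integral_expectile_spectrum_tail.
Qed.
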